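(* Let $M^2$ be a helicoidal surface (of first type) in the isotropic 3-space $\mathbb{I}^3$, parametrized by $\mathbf{r}(u,v)=(u\cos v,\,u\sin v,\,g(u)+hv)$ with $h\in\mathbb{R}$. Then the $v$-parameter curves (the curves $v=\mathrm{const.}$) on $M^2$ are geodesics of $M^2$, but the $u$-parameter curves (the curves $u=\mathrm{const.}$) are not.
   Context: The isotropic 3-space $\mathbb{I}^3$ is $\mathbb{R}^3$ with affine coordinates $(x_1,x_2,x_3)$ and the degenerate isotropic metric $dx_1^2+dx_2^2$ (the Euclidean metric of the top view $(x_1,x_2,x_3)\mapsto(x_1,x_2,0)$). In the parametrization $\mathbf{r}$, $u$ ranges over an interval not containing $0$ and $g$ is of class $C^2$. Let $\mathbf{r}(s)=\mathbf{r}(u(s),v(s))$ be a curve on $M^2$ parametrized by arc length $s$ with respect to the isotropic metric (i.e. the top view has Euclidean unit speed), and let a dot denote $d/ds$. Let $\mathbf{t}=\dot{\mathbf{r}}=(t_1,t_2,t_3)$ be its tangent vector, and let $\sigma=(\sigma_1,\sigma_2,\sigma_3)$ be the side tangential vector: the vector in the tangent plane of $M^2$ with $\sigma_1^2+\sigma_2^2=1$, $\sigma_1t_1+\sigma_2t_2=0$, $t_1\sigma_2-t_2\sigma_1=1$. Put $\mathbf{N}=(0,0,1)$. The decomposition $\ddot{\mathbf{r}}=\kappa_g\sigma+\kappa_n\mathbf{N}$ defines the geodesic curvature $\kappa_g$ and the normal curvature $\kappa_n$ of the curve on $M^2$. The curve is called a geodesic if and only if $\kappa_g$ vanishes. The paper's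 naming: ''$v$-parameter curves'' are the curves $v=\mathrm{const.}$ and ''$u$-parameter curves'' are the curves $u=\mathrm{const.}$ *)

(* Defs.v *)
From mathcomp Require Import all_boot all_order all_algebra.
From mathcomp Require Import all_classical all_reals all_analysis.
Set Implicit Arguments.
Unset Strict Implicit.
Unset Printing Implicit Defensive.
Import Order.TTheory GRing.Theory Num.Theory.
Import numFieldNormedType.Exports.
Local Open Scope classical_set_scope.
Local Open Scope ring_scope.

Section Calculus.
Variables (R : realType) (V : normedModType R).

Definition nondegenerate_interval (A : set R) : Prop :=
  is_interval A /\ exists x y, [/\ A x, A y & x < y].

(* Derivatives are taken relative to an interval A, so that they are the usual
   ones at interior points and the one-sided ones at end points in A. *)
Definition diffquot (f : R -> V) (x y : R) : V := (y - x)^-1 *: (f y - f x).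

Definition derivable_on (A : set R) (f : R -> V) : Prop :=
  forall x, A x -> cvg (diffquot f x y @[y --> within A x^']).

Definition deriv_on (A : set R) (f : R -> V) (x : R) : V :=
  lim (diffquot f x y @[y --> within A x^']).

Definition class_C2_on (A : set R) (f : R -> V) : Prop :=
  [/\ derivable_on A f, derivable_on A (deriv_on A f)
    & {within A, continuous (deriv_on A (deriv_on A f))}].

End Calculus.

Section IsotropicGeometry.
Variable R : realType.
Notation space := 'rV[R]_3.

Definition point3 (x1 x2 x3 : R) : space := \row_j [:: x1; x2; x3]`_j.

Definition coord1 (w : space) : R := w 0 0.
Definition coord2 (w : space) : R := w 0 1.

(* The polar form of the isotropic metric dx1^2 + dx2^2. *)
Definition iso_dot (w w' : space) : R :=
  coord1 w * coord1 w' + coord2 w * coord2 w'.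

Definition iso_N : space := point3 0 0 1.

(* A parametrized surface X has parameter domain I x R. *)
Definition tangent_vector (I : set R) (X : R -> R -> space) (u v : R)
    (w : space) : Prop :=
  exists a b : R, w = a *: deriv_on I (X^~ v) u + b *: derive1 (X u) v.

(* The functions u and v themselves are only constrained through the curve:
   its first two derivatives have to exist. *)
Definition arc_length_curve (I : set R) (X : R -> R -> space) (J : set R)
    (u v : R -> R) : Prop :=
  let r s := X (u s) (v s) in
  [/\ nondegenerate_interval J, forall s, J s -> I (u s),
      derivable_on J r, derivable_on J (deriv_on J r)
    & forall s, J s -> iso_dot (deriv_on J r s) (deriv_on J r s) = 1].

Definition side_tangential (I : set R) (X : R -> R -> space) (u v : R)
    (t sigma : space) : Prop :=
  [/\ tangent_vector I X u v sigma, iso_dot sigma sigma = 1,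
      iso_dot sigma t = 0
    & coord1 t * coord2 sigma - coord2 t * coord1 sigma = 1].

Definition curvature_decomposition (I : set R) (X : R -> R -> space)
    (J : set R) (u v : R -> R) (s kappa_g kappa_n : R) : Prop :=
  let t := deriv_on J (fun s => X (u s) (v s)) in
  exists2 sigma, side_tangential I X (u s) (v s) (t s) sigma
    & deriv_on J t s = kappa_g *: sigma + kappa_n *: iso_N.

Definition geodesic (I : set R) (X : R -> R -> space) (J : set R)
    (u v : R -> R) : Prop :=
  forall s, J s ->
    exists kappa_n, curvature_decomposition I X J u v s 0 kappa_n.

Definition helicoidal (g : R -> R) (h : R) (u v : R) : space :=
  point3 (u * cos v) (u * sin v) (g u + h * v).

End IsotropicGeometry.

(* Main.v *)
Require Import Defs.
From mathcomp Require Import all_boot all_order all_algebra.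
From mathcomp Require Import all_classical all_reals all_analysis.
From mathcomp Require Import ring.
Import Order.TTheory GRing.Theory Num.Theory.
Import numFieldNormedType.Exports.
Local Open Scope classical_set_scope.
Local Open Scope ring_scope.

(* Only inner products in the top view are differentiated.  A curve v = v0 has
   its top view on the line orthogonal to e = (- sin v0, cos v0), so its tangent
   t satisfies <t, e> = 0; differentiating this and <t, t> = 1 shows that the top
   view of dt/ds is orthogonal to both e and t, hence zero.  A curve u = u0 lies
   over the circle <r, r> = u0 ^ 2; differentiating twice gives
   <dt/ds, r> = - 1, whereas kappa_g = 0 would make dt/ds vertical. *)

(** Properness makes limits along this filter unique, so that [deriv_on] can be computed from any
    limit found. The interval has two points [a < b]: if [x <= a] there is room to step right
    towards [b], otherwise left towards [a], and convexity keeps the step inside [A]. *)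
Lemma within_dnbhs_proper (R : realType) (A : set R) (x : R) :
  nondegenerate_interval A -> A x -> ProperFilter (within A x^').
Proof.
move=> [itvA [a [b [Aa Ab ltab]]]] Ax.
have Fx : Filter (within A x^') by exact: within_filter.
split => //; rewrite /within /=.
move/nbhs_ballP => -[e /= e0 xe].
have [lexa|ltax] := leP x a.
- have ltxb := le_lt_trans lexa ltab.
  (* Halving [e] keeps [x + d] strictly inside the ball; the cap [b - x] keeps it from passing
     [b]. *)
  pose d := Num.min (e / 2) (b - x).
  have d0 : 0 < d by rewrite lt_min divr_gt0 //= subr_gt0.
  apply: (xe (x + d)).
  + rewrite /ball /= opprD addNKr normrN gtr0_norm //.
    by rewrite /d gt_min ltr_pdivrMr // ltr_pMr // ltr1n.
  + by rewrite -subr_eq0 addrAC subrr add0r gt_eqF.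
  + apply: (itvA x b) => //; rewrite lerDl ltW //= -lerBrDl.
    by rewrite /d ge_min lexx orbT.
- pose d := Num.min (e / 2) (x - a).
  have d0 : 0 < d by rewrite lt_min divr_gt0 //= subr_gt0.
  apply: (xe (x - d)).
  + rewrite /ball /= opprB addrC subrK gtr0_norm //.
    by rewrite /d gt_min ltr_pdivrMr // ltr_pMr // ltr1n.
  + by rewrite -subr_eq0 addrAC subrr add0r oppr_eq0 gt_eqF.
  + apply: (itvA a x) => //; rewrite gerBl (ltW d0) andbT lerBrDl -lerBrDr.
    by rewrite /d ge_min lexx orbT.
Qed.

Section RelativeDerivative.
Variables (R : realType) (A : set R).
Hypothesis itvA : nondegenerate_interval A.

Lemma diffquot_cst (V : normedModType R) (c : V) (x : R) :
  diffquot (fun=> c) x = fun=> 0.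
Proof. by apply/funext => y; rewrite /diffquot subrr scaler0. Qed.

Lemma derivable_on_cst (V : normedModType R) (c : V) :
  derivable_on A (fun=> c).
Proof. by move=> x Ax; rewrite diffquot_cst; exact: is_cvg_cst. Qed.

Lemma deriv_on_cst (V : normedModType R) (c : V) x : A x ->
  deriv_on A (fun=> c) x = 0.
Proof.
move=> Ax; rewrite /deriv_on diffquot_cst.
have PF := within_dnbhs_proper _ _ _ itvA Ax.
exact: lim_cst.
Qed.

Lemma cvg_diffquot (V : normedModType R) (f : R -> V) x :
  derivable_on A f -> A x ->
  diffquot f x y @[y --> within A x^'] --> deriv_on A f x.
Proof. by move=> df Ax; exact: df. Qed.

Lemma near_neq_within (x : R) : \forall y \near within A x^', y - x != 0.
Proof.
apply: cvg_within.
near=> y; rewrite subr_eq0.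
by near: y; exact: nbhs_dnbhs_neq.
Unshelve. all: by end_near. Qed.

(** Away from [x], [f y] equals [(y - x) *: diffquot f x y + f x], where the first factor tends to 0
    and the quotient converges. *)
Lemma derivable_on_continuous (V : normedModType R) (f : R -> V) x :
  derivable_on A f -> A x -> f y @[y --> within A x^'] --> f x.
Proof.
move=> df Ax; have PF := within_dnbhs_proper _ _ _ itvA Ax.
have idx : y @[y --> within A x^'] --> x.
  by move=> P /nbhs_dnbhs; exact: cvg_within.
have : (y - x) *: diffquot f x y + f x @[y --> within A x^']
    --> (x - x) *: deriv_on A f x + f x.
  apply: cvgD; last exact: cvg_cst.
  apply: cvgZ; last exact: cvg_diffquot.
  by apply: cvgB => //; exact: cvg_cst.
rewrite subrr scale0r add0r; apply: cvg_trans.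
apply: near_eq_cvg; near=> y.
rewrite /diffquot scalerA mulfV ?scale1r ?subrK //.
by near: y; exact: near_neq_within.
Unshelve. all: by end_near. Qed.

End RelativeDerivative.

Lemma cvg_iso_dot (R : realType) (T : Type) (F : set_system T)
    (f g : T -> 'rV[R]_3) (a b : 'rV[R]_3) : Filter F ->
  f @ F --> a -> g @ F --> b ->
  iso_dot (f x) (g x) @[x --> F] --> iso_dot a b.
Proof.
move=> FF fa gb; have co (h : T -> 'rV[R]_3) (c : 'rV[R]_3) j :
    h @ F --> c -> h x 0 j @[x --> F] --> c 0 j.
  move=> hc.
  exact: (cvg_comp _ _ hc (@coord_continuous R 1 3 0 j c)).
by apply: cvgD; apply: cvgM; exact: co.
Qed.

(** Leibniz rule for a constant product. The quotient of the product splits asymmetrically, with [g]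
    at the moving point [y] and [f] at [x], so the limit needs [g] to be continuous at [x]. *)
Lemma deriv_on_iso_dot_cst (R : realType) (A : set R) (f g : R -> 'rV[R]_3)
    (c x : R) :
  nondegenerate_interval A -> derivable_on A f -> derivable_on A g ->
  (forall y, A y -> iso_dot (f y) (g y) = c) -> A x ->
  iso_dot (deriv_on A f x) (g x) + iso_dot (f x) (deriv_on A g x) = 0.
Proof.
move=> itvA df dg fgc Ax; have PF := within_dnbhs_proper _ _ _ itvA Ax.
have h : iso_dot (diffquot f x y) (g y) + iso_dot (f x) (diffquot g x y)
    @[y --> within A x^'] -->
    iso_dot (deriv_on A f x) (g x) + iso_dot (f x) (deriv_on A g x).
  apply: cvgD; apply: cvg_iso_dot.
  - exact: cvg_diffquot.
  - exact: derivable_on_continuous.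
  - exact: cvg_cst.
  - exact: cvg_diffquot.
(* The split expression is the difference quotient of a function constant on [A], so it is also
   eventually 0. *)
apply: (@cvg_unique _ (@norm_hausdorff _ R) _ _ _ _ h).
apply: cvg_near_cst; near=> y.
have Ay : A y by near: y; exact: withinT.
have := fgc _ Ay; rewrite -(fgc _ Ax).
rewrite /diffquot /iso_dot /coord1 /coord2 !mxE => E.
apply: (@etrans _ _ ((y - x)^-1 * ((g y 0 0 * f y 0 0 + g y 0 1 * f y 0 1) -
  (f x 0 0 * g x 0 0 + f x 0 1 * g x 0 1)))); first ring.
by rewrite -E; ring.
Unshelve. all: by end_near. Qed.

Section Helicoidal.
Variables (R : realType) (g : R -> R) (h : R).

Lemma derive1_helicoidal (u v : R) :
  derive1 (helicoidal g h u) v = point3 (- (u * sin v)) (u * cos v) h.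
Proof.
have dE (i : 'I_1) (j : 'I_3) : is_derive v 1
    (fun w => helicoidal g h u w i j) (point3 (- (u * sin v)) (u * cos v) h i j).
  under eq_fun do rewrite mxE; rewrite mxE.
  case: j => -[|[|[|//]]] lt3 /=; apply: is_derive_eq;
    rewrite /GRing.scale /=; ring.
rewrite derive1E derive_mx; last by apply/derivable_mxP => i j; have [] := dE i j.
by apply/matrixP => i j; rewrite mxE; have [_ ->] := dE i j.
Qed.

Lemma iso_dot_helicoidal (u v : R) :
  iso_dot (helicoidal g h u v) (helicoidal g h u v) = u ^+ 2.
Proof.
rewrite /iso_dot /coord1 /coord2 !mxE /=.
rewrite -[RHS]mulr1 -(cos2Dsin2 v); ring.
Qed.

Variables (I : set R).
Hypothesis I0 : ~ I 0.

Lemma v_const_geodesic (v0 : R) (J : set R) (u v : R -> R) :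
  arc_length_curve I (helicoidal g h) J u v -> (forall s, J s -> v s = v0) ->
  geodesic I (helicoidal g h) J u v.
Proof.
move=> [itvJ JI dr dt tt1] vE s Js.
set r := (fun s => helicoidal g h (u s) (v s)) in dr dt tt1 *.
set t := deriv_on J r in dt tt1 *.
pose e : 'rV[R]_3 := point3 (- sin v0) (cos v0) 0.
have de : derivable_on J (fun=> e) by exact: derivable_on_cst.
have re y : J y -> iso_dot (r y) e = 0.
  by move=> Jy; rewrite /iso_dot /coord1 /coord2 !mxE /= (vE y Jy); ring.
have te y : J y -> iso_dot (t y) e = 0.
  move=> Jy; have := deriv_on_iso_dot_cst _ _ _ _ _ _ itvJ dr de re Jy.
  by rewrite deriv_on_cst // {2}/iso_dot /coord1 /coord2 !(mxE, mulr0, addr0).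
have t'e : iso_dot (deriv_on J t s) e = 0.
  have := deriv_on_iso_dot_cst _ _ _ _ _ _ itvJ dt de te Js.
  by rewrite deriv_on_cst // {2}/iso_dot /coord1 /coord2 !(mxE, mulr0, addr0).
have t't : iso_dot (deriv_on J t s) (t s) = 0.
  have := deriv_on_iso_dot_cst _ _ _ _ _ _ itvJ dt dt tt1 Js.
  set a := iso_dot _ _; set b := iso_dot _ _.
  (* By symmetry the two Leibniz terms agree, so twice the product vanishes. *)
  have -> : b = a by rewrite /a /b /iso_dot; ring.
  by move/eqP; rewrite -mulr2n mulrn_eq0 => /eqP.
move: (te s Js) t'e t't (tt1 s Js); rewrite /e.
set t' := deriv_on J t s; rewrite /iso_dot /coord1 /coord2 !mxE /=.
set x := t s 0 0; set y := t s 0 1; set x' := t' 0 0; set y' := t' 0 1.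
move=> te0 t'e0 t't0 tt0; have csE := cos2Dsin2 v0.
set c := cos v0 in te0 t'e0 csE; set d := sin v0 in te0 t'e0 csE.
(* The components of the top views of [t] and [t'] along the direction [(c, d)] of the line.
   Orthogonality to [e] makes each top view equal to its component times [(c, d)]; then unit speed
   gives [q * q = 1], and orthogonality of [t'] to [t] gives [q' * q = 0]. *)
pose q := x * c + y * d; pose q' := x' * c + y' * d.
have decomp a b : a * - d + b * c = 0 ->
    a = (a * c + b * d) * c /\ b = (a * c + b * d) * d.
  move=> ab0; split; apply/eqP; rewrite -subr_eq0; apply/eqP.
    by rewrite -[X in X - _]mulr1 -csE -[RHS](mul0r (- d)) -ab0; ring.
  by rewrite -[X in X - _]mulr1 -csE -[RHS](mul0r c) -ab0; ring.
have [xE yE] := decomp _ _ te0; have [x'E y'E] := decomp _ _ t'e0.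
rewrite -/q in xE yE; rewrite -/q' in x'E y'E.
have q2 : q * q = 1 by rewrite -tt0 xE yE -[LHS]mulr1 -csE; ring.
have q'0 : q' = 0.
  rewrite -[LHS]mulr1 -q2 -[LHS]mulr1 -csE -[RHS](mul0r q) -t't0 xE yE x'E y'E.
  by ring.
have u0 : u s != 0 by apply/eqP => us0; apply: I0; rewrite -us0; exact: JI.
(* The side tangential vector has top view [q] times [e], where [q], being 1 or -1, fixes the
   orientation. The partial derivative of the surface in [v] has top view [u s] times [e], hence the
   scaling by [q / u s], legitimate because [I] omits 0. The normal curvature is the height
   component of [t']. *)
exists (t' 0 (2%:R : 'I_3)),
  ((q / u s) *: point3 (- (u s * sin v0)) (u s * cos v0) h).
  split.
  - exists 0, (q / u s).
    by rewrite scale0r add0r derive1_helicoidal (vE s Js).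
  - rewrite /iso_dot /coord1 /coord2 !mxE /= -/c -/d.
    by transitivity (q * q * (c ^+ 2 + d ^+ 2)); [field | rewrite q2 csE mulr1].
  - rewrite /iso_dot /coord1 /coord2 !mxE /= -/r -/t -/x -/y -/c -/d xE yE.
    by field.
  - rewrite /iso_dot /coord1 /coord2 !mxE /= -/r -/t -/x -/y -/c -/d xE yE.
    by transitivity (q * q * (c ^+ 2 + d ^+ 2)); [field | rewrite q2 csE mulr1].
(* It remains to see that [t'] is vertical: its top view is [q'] times [(c, d)], and [q'] is 0. *)
rewrite scale0r add0r; apply/rowP => j; rewrite !mxE.
case: j => -[|[|[|//]]] lt3 /=.
- rewrite mulr0; transitivity x'; last by rewrite x'E q'0 mul0r.
  by congr (t' 0 _); exact: val_inj.
- rewrite mulr0; transitivity y'; last by rewrite y'E q'0 mul0r.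
  by congr (t' 0 _); exact: val_inj.
- by rewrite mulr1; congr (t' 0 _); exact: val_inj.
Qed.

Lemma u_const_not_geodesic (u0 : R) (J : set R) (u v : R -> R) :
  arc_length_curve I (helicoidal g h) J u v -> (forall s, J s -> u s = u0) ->
  ~ geodesic I (helicoidal g h) J u v.
Proof.
move=> [itvJ _ dr dt tt1] uE geo.
have [_ [s [_ [Js _ _]]]] := itvJ.
set r := (fun s => helicoidal g h (u s) (v s)) in dr dt tt1 *.
(* At a single parameter [s], vanishing geodesic curvature leaves [t'] equal to [k] times
   [iso_N]. *)
have [k [sigma _ /=]] := geo s Js.
rewrite -/r scale0r add0r; set t := deriv_on J r in dt tt1 * => t'E.
have rr y : J y -> iso_dot (r y) (r y) = u0 ^+ 2.
  by move=> Jy; rewrite /r iso_dot_helicoidal uE.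
have tr y : J y -> iso_dot (t y) (r y) = 0.
  move=> Jy; have := deriv_on_iso_dot_cst _ _ _ _ _ _ itvJ dr dr rr Jy.
  rewrite -/t; set a := iso_dot _ _; set b := iso_dot _ _.
  have -> : b = a by rewrite /a /b /iso_dot; ring.
  by move/eqP; rewrite -mulr2n mulrn_eq0 => /eqP.
(* Here the derivative of [r] is [t], so the Leibniz terms are the product of [t'] with [r], which
   is 0 for vertical [t'], and that of [t] with itself, which is 1. Their sum being 0 reads
   [1 = 0]. *)
have := deriv_on_iso_dot_cst _ _ _ _ _ _ itvJ dt dr tr Js.
rewrite -/t t'E tt1 // /iso_dot /coord1 /coord2 !mxE /= !(mulr0, mul0r, add0r).
by apply/eqP; rewrite oner_eq0.
Qed.

End Helicoidal.

Theorem theorem4p1 (R : realType) (I : set R) (g : R -> R) (h : R)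
    (hI : nondegenerate_interval I) (hI0 : ~ I 0) (hg : class_C2_on I g) :
  (forall (v0 : R) (J : set R) (u v : R -> R),
      arc_length_curve I (helicoidal g h) J u v ->
      (forall s, J s -> v s = v0) ->
      geodesic I (helicoidal g h) J u v) /\
  (forall (u0 : R) (J : set R) (u v : R -> R),
      I u0 ->
      arc_length_curve I (helicoidal g h) J u v ->
      (forall s, J s -> u s = u0) ->
      ~ geodesic I (helicoidal g h) J u v).
Proof.
split=> [v0 J u v | u0 J u v _]; first exact: v_const_geodesic.
exact: u_const_not_geodesic.
Qed.
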